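(* Let $c\in\mathbb{E}^3$, $r>0$, let $x:U\to\mathbb{E}^3\setminus\{c\}$ be a patch and let $y=\Phi\circ x$ be its inverse patch, where $\Phi$ is the inversion with center $c$ and radius $r$. Then regularity and singularity are invariant under the inversion: for every $(u_0,v_0)\in U$, if $x$ is regular at $(u_0,v_0)$ then $y$ is regular at $(u_0,v_0)$, and if $x$ is singular at $(u_0,v_0)$ then $y$ is singular at $(u_0,v_0)$.
   Context: $\mathbb{E}^3$ is Euclidean 3-space with its standard inner product. The inversion with center $c$ and radius $r$ is the map $\Phi:\mathbb{E}^3\setminus\{c\}\to\mathbb{E}^3\setminus\{c\}$, $\Phi(p)=c+\frac{r^2}{\|p-c\|^2}(p-c)$. A patch is a smooth map $x:U\to\mathbb{E}^3\setminus\{c\}$ defined on an open set $U\subset\mathbb{R}^2$ with coordinates $(u,v)$; its partial derivatives are $x_u,x_v$. A patch $x$ is regular at $(u_0,v_0)$ if $x_u\times x_v\neq 0$ at $(u_0,v_0)$, and singular at $(u_0,v_0)$ if $x_u\times x_v=0$ there. *)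

(* Defs.v *)
From mathcomp Require Import all_boot all_order all_algebra.
From mathcomp Require Import all_classical all_reals all_analysis.

Set Implicit Arguments.
Unset Strict Implicit.
Unset Printing Implicit Defensive.

Import Order.TTheory GRing.Theory Num.Theory.
Import numFieldNormedType.Exports.

Local Open Scope classical_set_scope.
Local Open Scope ring_scope.

(* The library norm `|p| on row vectors is the sup norm; it induces the same
   topology and derivatives as the Euclidean norm, but it is not the norm that
   occurs in the formula for the inversion. *)
Definition edot (R : realType) (n : nat) (p q : 'rV[R]_n) : R :=
  \sum_i p 0 i * q 0 i.

Definition enorm (R : realType) (n : nat) (p : 'rV[R]_n) : R :=
  Num.sqrt (edot p p).

Definition cross (R : realType) (p q : 'rV[R]_3) : 'rV[R]_3 :=
  let p0 := p 0 (inord 0) in let p1 := p 0 (inord 1) in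
  let p2 := p 0 (inord 2) in
  let q0 := q 0 (inord 0) in let q1 := q 0 (inord 1) in
  let q2 := q 0 (inord 2) in
  \row_(j < 3) [:: p1 * q2 - p2 * q1; p2 * q0 - p0 * q2; p0 * q1 - p1 * q0]`_j.

(* Total on E^3; only the values at p <> c are meaningful (the value at c is
   the junk value c). *)
Definition inversion (R : realType) (c : 'rV[R]_3) (r : R) (p : 'rV[R]_3) :
    'rV[R]_3 :=
  c + (r ^+ 2 / enorm (p - c) ^+ 2) *: (p - c).

(* Index 0 is the coordinate u, index 1 is the coordinate v. *)
Definition partial (R : realType) (m n : nat) (i : 'I_m)
    (f : 'rV[R]_m -> 'rV[R]_n) : 'rV[R]_m -> 'rV[R]_n :=
  fun p => 'D_(delta_mx 0 i) f p.

Definition iter_partial (R : realType) (m n : nat) (s : seq 'I_m)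
    (f : 'rV[R]_m -> 'rV[R]_n) : 'rV[R]_m -> 'rV[R]_n :=
  foldr (@partial R m n) f s.

(* C^infinity on the open set U: the partial derivatives of all orders (order
   0 included) exist and are continuous at every point of U.  Since U is open,
   this does not depend on the values of f outside U. *)
Definition smooth_on (R : realType) (m n : nat) (U : set 'rV[R]_m)
    (f : 'rV[R]_m -> 'rV[R]_n) : Prop :=
  forall (s : seq 'I_m) (p : 'rV[R]_m), U p ->
    {for p, continuous (iter_partial s f)} /\
    forall i : 'I_m, derivable (iter_partial s f) p (delta_mx 0 i).

Definition is_patch (R : realType) (c : 'rV[R]_3) (U : set 'rV[R]_2)
    (x : 'rV[R]_2 -> 'rV[R]_3) : Prop :=
  [/\ open U, smooth_on U x & forall p, U p -> x p <> c].

Definition partial_u (R : realType) (x : 'rV[R]_2 -> 'rV[R]_3) :=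
  partial (inord 0) x.

Definition partial_v (R : realType) (x : 'rV[R]_2 -> 'rV[R]_3) :=
  partial (inord 1) x.

Definition regular_at (R : realType) (x : 'rV[R]_2 -> 'rV[R]_3)
    (p : 'rV[R]_2) : Prop :=
  cross (partial_u x p) (partial_v x p) <> 0.

Definition singular_at (R : realType) (x : 'rV[R]_2 -> 'rV[R]_3)
    (p : 'rV[R]_2) : Prop :=
  cross (partial_u x p) (partial_v x p) = 0.

(* Main.v *)
(** Write [q = x - c]. The product rule gives
    [D_v y = (r / |q|^2)^2 (|q|^2 D_v x - 2 <q, D_v x> q)], so up to a nonzero
    scalar the differential of the inversion is the reflection in the plane
    orthogonal to [q]. A reflection of determinant -1 sends a cross product
    to minus the cross product of the images, and it is invertible, hence
    [y_u x y_v] vanishes exactly when [x_u x x_v] does. *)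
Require Import Defs.
From mathcomp Require Import all_boot all_order all_algebra.
From mathcomp Require Import all_classical all_reals all_analysis.
From mathcomp Require Import ring.

Import Order.TTheory GRing.Theory Num.Theory.
Import numFieldNormedType.Exports.

Local Open Scope classical_set_scope.
Local Open Scope ring_scope.

(* The scaling by [|q|^2] keeps the reflection polynomial in [q]. *)
Definition scaled_reflection {R : realType} {n : nat} (q a : 'rV[R]_n) :
    'rV[R]_n :=
  edot q q *: a - (2 * edot q a) *: q.

Lemma edot_self_eq0 (R : realType) (n : nat) (q : 'rV[R]_n) :
  (edot q q == 0) = (q == 0).
Proof.
apply/eqP/eqP => [q0|->]; last first.
  by rewrite /edot big1// => i _; rewrite mxE mul0r.
apply/rowP => i; rewrite mxE; apply/eqP.
rewrite -sqrf_eq0 expr2; apply/eqP.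
by apply: (psumr_eq0P _ q0) => // j _; rewrite -expr2 sqr_ge0.
Qed.

Lemma enorm_sqr (R : realType) (n : nat) (q : 'rV[R]_n) :
  enorm q ^+ 2 = edot q q.
Proof.
by rewrite sqr_sqrtr// sumr_ge0// => i _; rewrite -expr2 sqr_ge0.
Qed.

(** The component along [q] changes sign: the coefficient is [1 - 2 = -1], times the scaling
    [edot q q]. *)
Lemma edot_reflection (R : realType) (n : nat) (q a : 'rV[R]_n) :
  edot q (scaled_reflection q a) = - (edot q q * edot q a).
Proof.
have edotB k l : edot q (k *: a - l *: q) = k * edot q a - l * edot q q.
  rewrite /edot !mulr_sumr -sumrB; apply: eq_bigr => i _.
  by rewrite !mxE; ring.
rewrite edotB.
by ring.
Qed.

(** A reflection is an involution, so only the square of the scaling factor survives. *)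
Lemma scaled_reflectionK (R : realType) (n : nat) (q a : 'rV[R]_n) :
  scaled_reflection q (scaled_reflection q a) = edot q q ^+ 2 *: a.
Proof.
rewrite {1}/scaled_reflection edot_reflection.
by apply/rowP => i; rewrite !mxE; ring.
Qed.

(** Injectivity: applying the map twice multiplies by [edot q q ^+ 2], which is nonzero for
    [q != 0]. *)
Lemma scaled_reflection_eq0 (R : realType) (n : nat) (q a : 'rV[R]_n) :
  q != 0 -> (scaled_reflection q a == 0) = (a == 0).
Proof.
move=> q0; apply/eqP/eqP => [a0|->]; last first.
  apply/rowP => i; rewrite !mxE [edot q 0]big1 ?mulr0 ?mul0r ?subrr//.
  by move=> j _; rewrite mxE mulr0.
have /eqP := scaled_reflectionK R n q a.
rewrite a0 /scaled_reflection scaler0 [edot q 0]big1; last first.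
  by move=> j _; rewrite mxE mulr0.
rewrite mulr0 scale0r subrr eq_sym scaler_eq0 sqrf_eq0 edot_self_eq0.
by rewrite (negPf q0) => /eqP.
Qed.

Lemma edot3 (R : realType) (p q : 'rV[R]_3) :
  edot p q = p 0 (inord 0) * q 0 (inord 0) + p 0 (inord 1) * q 0 (inord 1)
             + p 0 (inord 2) * q 0 (inord 2).
Proof.
rewrite /edot !big_ord_recr big_ord0 /= add0r.
by do ?[congr (_ + _)|congr (_ * _)]; congr (_ 0 _);
  apply/val_inj; rewrite /= inordK.
Qed.

Lemma cross_scale (R : realType) (k l : R) (a b : 'rV[R]_3) :
  cross (k *: a) (l *: b) = (k * l) *: cross a b.
Proof.
by apply/rowP => -[[|[|[|j]]] jP]//; rewrite !mxE /= ?mxE; ring.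
Qed.

(** A linear map acts on cross products through its cofactor matrix. For [|q|^2 S], with [S]
    orthogonal of determinant -1, this matrix is [- |q|^4 S]. The proof checks the resulting
    polynomial identity in each coordinate. *)
Lemma cross_reflection (R : realType) (q a b : 'rV[R]_3) :
  cross (scaled_reflection q a) (scaled_reflection q b) =
  - edot q q *: scaled_reflection q (cross a b).
Proof.
apply/rowP => i; rewrite [in RHS]mxE [in RHS]mxE [in RHS]mxE [in RHS]mxE.
rewrite !edot3 /scaled_reflection !edot3.
(* The numerical values of the indices let the list lookups in [cross] compute. *)
have e0 : (inord 0 : 'I_3) = 0%N :> nat by rewrite inordK.
have e1 : (inord 1 : 'I_3) = 1%N :> nat by rewrite inordK.
have e2 : (inord 2 : 'I_3) = 2%N :> nat by rewrite inordK.
rewrite !mxE e0 e1 e2 /=.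
have [->|->|->] : [\/ i = inord 0, i = inord 1 | i = inord 2].
  case: i => [[|[|[|j]]] jP]//;
  [apply: Or31|apply: Or32|apply: Or33]; by apply/val_inj; rewrite /= inordK.
all: by rewrite ?e0 ?e1 ?e2 /=; ring.
Qed.

Lemma derive_inversion (R : realType) (V : normedModType R) (c : 'rV[R]_3)
    (r : R) (x : V -> 'rV[R]_3) (p v : V) :
  x p != c -> derivable x p v ->
  'D_v (inversion c r \o x) p =
  (r / edot (x p - c) (x p - c)) ^+ 2 *: scaled_reflection (x p - c) ('D_v x p).
Proof.
move=> xc dx; set q := x p - c.
have q0 : edot q q != 0 by rewrite edot_self_eq0 subr_eq0.
pose X i t := (x t - c) 0 i.
(* The inversion is differentiated coordinate by coordinate, from the coordinates [X i] of [x - c]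
   and their sum of squares [Q]. *)
have dX i : is_derive p v (X i) ('D_v x p 0 i).
  have -> : X i = (fun t => x t 0 i) - cst (c 0 i).
    by apply/funext => t; rewrite /X !mxE.
  rewrite derive_mx// mxE -[X in is_derive _ _ _ X]subr0.
  apply: is_deriveB; split => //.
  by have /derivable_mxP := dx; exact.
pose Q t := edot (x t - c) (x t - c).
have dQ : is_derive p v Q (2 * edot q ('D_v x p)).
  have -> : Q = \sum_i X i * X i.
    by apply/funext => t; rewrite /Q /edot fct_sumE.
  rewrite mulr_sumr; apply: is_derive_sum => i.
  apply: is_derive_eq; rewrite -/(q 0 i) /GRing.scale /= /X -/q.
  by ring.
(* Here [x p != c] enters, through [Q p != 0]. *)
have dQV : is_derive p v (fun t => (Q t)^-1)
    (- (edot q q) ^- 2 * (2 * edot q ('D_v x p))).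
  split; first by apply: derivableV.
  by rewrite deriveV// derive_val.
have dy i : is_derive p v (fun t => (inversion c r \o x) t 0 i)
    (((r / edot q q) ^+ 2 *: scaled_reflection q ('D_v x p)) 0 i).
  have -> : (fun t => (inversion c r \o x) t 0 i) =
      cst (c 0 i) + (r ^+ 2 \*: ((fun t => (Q t)^-1) * X i)).
    apply/funext => t; rewrite /= /inversion enorm_sqr !mxE.
    rewrite -[RHS]/(c 0 i + r ^+ 2 * ((Q t)^-1 * X i t)) /X /Q.
    by rewrite !mxE mulrA.
  apply: is_derive_eq.
  rewrite !mxE /GRing.scale /= /X /Q -/q /q !mxE -/q.
  by field.
rewrite derive_mx.
  by apply/rowP => i; rewrite mxE derive_val.
by apply/derivable_mxP => i j; rewrite (ord1 i); exact: ex_derive.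
Qed.

(** The two cross products differ by an injective map and by scalars that are nonzero since [r != 0]
    and [x p != c]. *)
Lemma cross_derive_inversion_eq0 (R : realType) (V : normedModType R)
    (c : 'rV[R]_3) (r : R) (x : V -> 'rV[R]_3) (p v w : V) :
  r != 0 -> x p != c -> derivable x p v -> derivable x p w ->
  (cross ('D_v (inversion c r \o x) p) ('D_w (inversion c r \o x) p) == 0) =
  (cross ('D_v x p) ('D_w x p) == 0).
Proof.
move=> r0 xc dv dw; rewrite !derive_inversion// cross_scale cross_reflection.
have q0 : x p - c != 0 by rewrite subr_eq0.
rewrite !scaler_eq0 scaled_reflection_eq0// oppr_eq0 invr_eq0.
by rewrite edot_self_eq0 (negPf q0) (negPf r0).
Qed.

Theorem theorem3p1 (R : realType) (c : 'rV[R]_3) (r : R) (U : set 'rV[R]_2)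
    (x : 'rV[R]_2 -> 'rV[R]_3) (r_gt0 : 0 < r) (x_patch : is_patch c U x) :
  let y := inversion c r \o x in
  forall p0 : 'rV[R]_2, U p0 ->
    (regular_at x p0 -> regular_at y p0) /\
    (singular_at x p0 -> singular_at y p0).
Proof.
move=> y p Up; have [_ smooth_x x_neq_c] := x_patch.
(* The empty list of partial derivatives selects [x] itself. *)
have dx i : derivable x p (delta_mx 0 i) by have [_] := smooth_x [::] p Up; exact.
have xc : x p != c by apply/eqP; exact: x_neq_c.
have r0 : r != 0 by rewrite gt_eqF.
rewrite /regular_at /singular_at /partial_u /partial_v /partial.
have E := cross_derive_inversion_eq0 _ _ c r x p _ _ r0 xc (dx _) (dx _).
by split=> [/eqP xN0|/eqP x0]; apply/eqP; rewrite E.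
Qed.
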